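(* Let $\xi=(L,p,M)$ be a Lie-Yamaguti algebra bundle and let $(\eta;\rho,D,\theta)$ be a representation of $\xi$ on a vector bundle $\eta$ over $M$. For every integer $p\ge 1$, the coboundary operators $$\delta=(\delta_I,\delta_{II}):C^{2p}(\xi;\eta)\times C^{2p+1}(\xi;\eta)\to C^{2p+2}(\xi;\eta)\times C^{2p+3}(\xi;\eta)$$ satisfy $\delta\circ\delta=0$.
   Context: All manifolds, vector bundles and bundle maps are smooth and real; bundle maps between bundles over $M$ cover the identity of $M$. Lie-Yamaguti algebra: a vector space $\mathfrak g$ with a bilinear operation $[\ ,\ ]$ and a trilinear operation $\{\ ,\ ,\ \}$ such that for all $x,y,z,u,v,w\in\mathfrak g$: (LY1) $[x,y]=-[y,x]$; (LY2) $\{x,y,z\}=-\{y,x,z\}$; (LY3) $\sum_{\circlearrowleft(x,y,z)}([[x,y],z]+\{x,y,z\})=0$; (LY4) $\sum_{\circlearrowleft(x,y,z)}\{[x,y],z,u\}=0$; (LY5) $\{x,y,[u,v]\}=[\{x,y,u\},v]+[u,\{x,y,v\}]$; (LY6) $\{x,y,\{u,v,w\}\}=\{\{x,y,u\},v,w\}+\{u,\{x,y,v\},w\}+\{u,v,\{x,y,w\}\}$, where $\sum_{\circlearrowleft(x,y,z)}$ is the sum over cyclic permutations. A Lie-Yamaguti algebra bundle is a vector bundle $\xi=(L,p,M)$ with smooth sections $m\mapsto[\ ,\ ]_m$ of $\mathrm{Hom}(\xi^{\otimes2},\xi)$ and $m\mapsto\{\ ,\ ,\ \}_m$ of $\mathrm{Hom}(\xi^{\otimes3},\xi)$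 making each fibre $\xi_m$ a Lie-Yamaguti algebra. A representation $(\eta;\rho,D,\theta)$ of $\xi$ on a vector bundle $\eta$ over $M$ consists of vector bundle morphisms $\rho:\xi\to\mathrm{End}(\eta)$ and $D,\theta:\xi\otimes\xi\to\mathrm{End}(\eta)$ such that for all $m\in M$ and $a,b,c,d\in\xi_m$ (subscript $m$ denotes restriction to the fibre, and brackets of endomorphisms are commutators): (RLYB1) $D_m(a,b)+\theta_m(a,b)-\theta_m(b,a)=[\rho_m(a),\rho_m(b)]-\rho_m([a,b]_m)$; (RLYB2) $\theta_m(a,[b,c]_m)-\rho_m(b)\theta_m(a,c)+\rho_m(c)\theta_m(a,b)=0$; (RLYB3) $\theta_m([a,b]_m,c)-\theta_m(a,c)\rho_m(b)+\theta_m(b,c)\rho_m(a)=0$; (RLYB4) $\theta_m(c,d)\theta_m(a,b)-\theta_m(b,d)\theta_m(a,c)-\theta_m(a,\{b,c,d\}_m)+D_m(b,c)\theta_m(a,d)=0$; (RLYB5) $[D_m(a,b),\rho_m(c)]=\rho_m(\{a,b,c\}_m)$; (RLYB6) $[D_m(a,b),\theta_m(c,d)]=\theta_m(\{a,b,c\}_m,d)+\theta_m(c,\{a,b,d\}_m)$. Cochains: for $n\ge2$, $C^n(\xi;\eta)$ is the space of vector bundle maps $f:\xi^{\otimes n}\to\eta$ such that the fibrewise $n$-linear maps $f_m:\xi_m\times\cdots\times\xi_m\to\eta_m$ satisfy $f_m(x_1,\dots,x_n)=0$ whenever $x_{2i-1}=x_{2i}$ for some $i\in\{1,\dots,\lfloor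 n/2\rfloor\}$. Coboundary: for $p\ge1$ and $(f,g)\in C^{2p}(\xi;\eta)\times C^{2p+1}(\xi;\eta)$, $\delta(f,g)=(\delta_I(f,g),\delta_{II}g)$ is defined fibrewise, for $m\in M$ and $x_i\in\xi_m$, by $$\begin{aligned} \delta_I(f,g)_m(x_1,\dots,x_{2p+2})={}&(-1)^p\big[\rho_m(x_{2p+1})g_m(x_1,\dots,x_{2p},x_{2p+2})-\rho_m(x_{2p+2})g_m(x_1,\dots,x_{2p},x_{2p+1})\\ &\quad-g_m(x_1,\dots,x_{2p},[x_{2p+1},x_{2p+2}]_m)\big]\\ &+\sum_{k=1}^{p}(-1)^{k+1}D_m(x_{2k-1},x_{2k})f_m(x_1,\dots,\hat x_{2k-1},\hat x_{2k},\dots,x_{2p+2})\\ &+\sum_{k=1}^{p+1}\sum_{j=2k+1}^{2p+2}(-1)^kf_m(x_1,\dots,\hat x_{2k-1},\hat x_{2k},\dots,\{x_{2k-1},x_{2k},x_j\}_m,\dots,x_{2p+2}), \end{aligned}$$ $$\begin{aligned} (\delta_{II}g)_m(x_1,\dots,x_{2p+3})={}&(-1)^p\big[\theta_m(x_{2p+2},x_{2p+3})g_m(x_1,\dots,x_{2p+1})-\theta_m(x_{2p+1},x_{2p+3})g_m(x_1,\dots,x_{2p},x_{2p+2})\big]\\ &+\sum_{k=1}^{p+1}(-1)^{k+1}D_m(x_{2k-1},x_{2k})g_m(x_1,\dots,\hat x_{2k-1},\hat x_{2k},\dots,x_{2p+3})\\ &+\sum_{k=1}^{p+1}\sum_{j=2k+1}^{2p+3}(-1)^kg_m(x_1,\dots,\hat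 x_{2k-1},\hat x_{2k},\dots,\{x_{2k-1},x_{2k},x_j\}_m,\dots,x_{2p+3}). \end{aligned}$$ Hats denote omission, $\{x_{2k-1},x_{2k},x_j\}_m$ replaces $x_j$ in its position, and empty sums are zero. The composite $\delta\circ\delta$ is from $C^{2p}\times C^{2p+1}$ to $C^{2p+4}\times C^{2p+5}$. *)

(* Defs.v *)
From HB Require Import structures.
From mathcomp Require Import all_boot all_order all_algebra.
From mathcomp Require Import all_classical all_reals all_analysis.

Set Implicit Arguments.
Unset Strict Implicit.
Unset Printing Implicit Defensive.

Import Order.TTheory GRing.Theory Num.Theory.
Import numFieldNormedType.Exports.

Local Open Scope classical_set_scope.
Local Open Scope ring_scope.

(* [U] is meant to be open in the definitions below: continuity and
   derivability are required at each point of [U], in the ambient space. *)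
Fixpoint Ck (R : realType) (n k : nat) (U : set 'rV[R]_n) (f : 'rV[R]_n -> R)
    : Prop :=
  (forall x, U x -> {for x, continuous f}) /\
  (if k is k'.+1 then
     forall i : 'I_n,
       (forall x, U x -> derivable f x (delta_mx 0 i)) /\
       Ck k' U (fun x => 'D_(delta_mx 0 i) f x)
   else True).

Definition smooth (R : realType) (n : nat) (U : set 'rV[R]_n)
    (f : 'rV[R]_n -> R) : Prop :=
  forall k, Ck k U f.

Definition smoothv (R : realType) (n r : nat) (U : set 'rV[R]_n)
    (F : 'rV[R]_n -> 'rV[R]_r) : Prop :=
  forall j : 'I_r, smooth U (fun x => F x 0 j).

(* A homeomorphism from an open set of [X] onto an open set of R^n; the values
   of [ch_map] and [ch_inv] outside these sets are irrelevant. *)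
Record chart (R : realType) (n : nat) (X : topologicalType) := Chart {
  ch_dom : set X;
  ch_map :> X -> 'rV[R]_n;
  ch_inv : 'rV[R]_n -> X;
  ch_dom_open : open ch_dom;
  ch_img_open : open (ch_map @` ch_dom);
  ch_mapK : forall x, ch_dom x -> ch_inv (ch_map x) = x;
  ch_map_cont : forall x, ch_dom x -> {for x, continuous ch_map};
  ch_inv_cont : forall y, (ch_map @` ch_dom) y -> {for y, continuous ch_inv} }.

Record manifold (R : realType) := Manifold {
  mf_space :> topologicalType;
  mf_dim : nat;
  mf_atlas : set (chart R mf_dim mf_space);
  mf_hausdorff : hausdorff_space mf_space;
  mf_second_countable : @second_countable mf_space;
  mf_cover : forall x : mf_space, exists2 c, mf_atlas c & ch_dom c x;
  mf_compat : forall c d, mf_atlas c -> mf_atlas d ->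
    smoothv (c @` (ch_dom c `&` ch_dom d)) (fun y => d (ch_inv c y)) }.

Definition smooth_fun (R : realType) (X : manifold R) (U : set X) (h : X -> R)
    : Prop :=
  forall c, mf_atlas c ->
    smooth (c @` (U `&` ch_dom c)) (fun y => h (ch_inv c y)).

Definition smooth_map (R : realType) (X Y : manifold R) (F : X -> Y) : Prop :=
  continuous F /\
  forall (c : chart R (mf_dim X) X) (d : chart R (mf_dim Y) Y),
    mf_atlas c -> mf_atlas d ->
    smoothv (c @` (ch_dom c `&` F @^-1` ch_dom d))
            (fun y => d (F (ch_inv c y))).

(* A map of manifolds whose fibres are real vector spaces. *)
Record fibred (R : realType) (M : manifold R) := Fibred {
  fb_total : manifold R;
  fb_proj : fb_total -> M;
  fb_lmod : forall m : M, GRing.Lmodule R {x : fb_total | fb_proj x = m} }.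

Definition fibre (R : realType) (M : manifold R) (E : fibred M) (m : M)
    : lmodType R :=
  GRing.Lmodule.Pack (fb_lmod E m).

Coercion fibre : fibred >-> Funclass.

Definition total_pt (R : realType) (M : manifold R) (E : fibred M) (m : M)
    (v : E m) : fb_total E :=
  proj1_sig v.

(* The diffeomorphism p^-1(U) -> U x R^r is x |-> (p x, lt_map x), and its
   inverse is (m, v) |-> lt_inv m v. Smoothness of the latter is read in the
   product charts c x id of U x R^r. *)
Record local_triv (R : realType) (M : manifold R) (E : fibred M) (r : nat) :=
  LocalTriv {
  lt_dom : set M;
  lt_map : fb_total E -> 'rV[R]_r;
  lt_inv : forall m, 'rV[R]_r -> E m;
  lt_open : open lt_dom;
  lt_linear : forall m, lt_dom m -> linear (fun v : E m => lt_map (total_pt v));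
  lt_mapK : forall m (v : E m), lt_dom m -> lt_inv m (lt_map (total_pt v)) = v;
  lt_invK : forall m y, lt_dom m -> lt_map (total_pt (lt_inv m y)) = y;
  lt_map_smooth : forall j : 'I_r,
    smooth_fun (@fb_proj _ _ E @^-1` lt_dom) (fun x => lt_map x 0 j);
  lt_inv_cont : forall m y, lt_dom m ->
    {for (m, y), continuous
       (fun q : M * 'rV[R]_r => total_pt (lt_inv q.1 q.2))};
  lt_inv_smooth : forall (c : chart R (mf_dim M) M)
      (d : chart R (mf_dim (fb_total E)) (fb_total E)),
    mf_atlas c -> mf_atlas d ->
    smoothv
      [set w : 'rV[R]_(mf_dim M + r) |
        (c @` (lt_dom `&` ch_dom c)) (lsubmx w) /\
        ch_dom d (total_pt (lt_inv (ch_inv c (lsubmx w)) (rsubmx w)))]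
      (fun w => d (total_pt (lt_inv (ch_inv c (lsubmx w)) (rsubmx w)))) }.

Record vbundle (R : realType) (M : manifold R) := VBundle {
  vb_fibred :> fibred M;
  vb_rank : nat;
  vb_proj_smooth : smooth_map (@fb_proj _ _ vb_fibred);
  vb_triv : forall m : M, exists t : local_triv vb_fibred vb_rank, lt_dom t m }.

Definition frame (R : realType) (M : manifold R) (E : fibred M) (r : nat)
    (t : local_triv E r) (i : 'I_r) (m : M) : E m :=
  lt_inv t m (delta_mx 0 i).

Definition coord (R : realType) (M : manifold R) (E : fibred M) (r : nat)
    (t : local_triv E r) (j : 'I_r) (m : M) (v : E m) : R :=
  lt_map t (total_pt v) 0 j.

Definition multilinear (R : realType) (V W : lmodType R) (n : nat)
    (f : ('I_n -> V) -> W) : Prop :=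
  forall (i : 'I_n) (x : 'I_n -> V),
    linear (fun u : V => f (fun j => if j == i then u else x j)).

(* Bundle maps E^{(x) n} -> F, i.e. smooth sections of Hom(E^{(x) n}, F): the
   local expression in the frames e_{i_1} (x) ... (x) e_{i_n} is smooth. *)
Definition bundle_map (R : realType) (M : manifold R) (E F : vbundle M)
    (n : nat) (f : forall m, ('I_n -> E m) -> F m) : Prop :=
  (forall m, multilinear (f m)) /\
  forall (s : local_triv E (vb_rank E)) (t : local_triv F (vb_rank F))
      (I : 'I_n -> 'I_(vb_rank E)) (j : 'I_(vb_rank F)),
    smooth_fun (lt_dom s `&` lt_dom t)
      (fun m => coord t j (f m (fun k => frame s (I k) m))).

(* Bundle maps E^{(x) n} -> End(F); in a local frame of F the endomorphisms
   become matrices. *)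
Definition bundle_map_end (R : realType) (M : manifold R) (E F : vbundle M)
    (n : nat) (h : forall m, ('I_n -> E m) -> {linear F m -> F m}) : Prop :=
  (forall m (v : F m), multilinear (fun x => h m x v)) /\
  forall (s : local_triv E (vb_rank E)) (t : local_triv F (vb_rank F))
      (I : 'I_n -> 'I_(vb_rank E)) (l j : 'I_(vb_rank F)),
    smooth_fun (lt_dom s `&` lt_dom t)
      (fun m => coord t j (h m (fun k => frame s (I k) m) (frame t l m))).

Record is_lie_yamaguti (R : realType) (V : lmodType R)
    (br : V -> V -> V) (tr : V -> V -> V -> V) : Prop := IsLieYamaguti {
  LY_br_linearl : forall y, linear (fun x => br x y);
  LY_br_linearr : forall x, linear (fun y => br x y);
  LY_tr_linear1 : forall y z, linear (fun x => tr x y z);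
  LY_tr_linear2 : forall x z, linear (fun y => tr x y z);
  LY_tr_linear3 : forall x y, linear (fun z => tr x y z);
  LY1 : forall x y, br x y = - br y x;
  LY2 : forall x y z, tr x y z = - tr y x z;
  LY3 : forall x y z,
    (br (br x y) z + tr x y z) + (br (br y z) x + tr y z x)
    + (br (br z x) y + tr z x y) = 0;
  LY4 : forall x y z u,
    tr (br x y) z u + tr (br y z) x u + tr (br z x) y u = 0;
  LY5 : forall x y u v,
    tr x y (br u v) = br (tr x y u) v + br u (tr x y v);
  LY6 : forall x y u v w,
    tr x y (tr u v w)
    = tr (tr x y u) v w + tr u (tr x y v) w + tr u v (tr x y w) }.

Record lie_yamaguti_bundle (R : realType) (M : manifold R) :=
  LieYamagutiBundle {
  ly_vbundle :> vbundle M;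
  ly_br : forall m, ly_vbundle m -> ly_vbundle m -> ly_vbundle m;
  ly_tr : forall m,
    ly_vbundle m -> ly_vbundle m -> ly_vbundle m -> ly_vbundle m;
  ly_br_smooth : @bundle_map R M ly_vbundle ly_vbundle 2
    (fun m x => ly_br (x ord0) (x ord_max));
  ly_tr_smooth : @bundle_map R M ly_vbundle ly_vbundle 3
    (fun m x => ly_tr (x ord0) (x (inord 1)) (x ord_max));
  ly_axioms : forall m, is_lie_yamaguti (@ly_br m) (@ly_tr m) }.

Arguments ly_br {R M} l {m} _ _.
Arguments ly_tr {R M} l {m} _ _ _.

Record representation (R : realType) (M : manifold R)
    (xi : lie_yamaguti_bundle M) (eta : vbundle M) := Representation {
  rho : forall m, xi m -> {linear eta m -> eta m};
  rD : forall m, xi m -> xi m -> {linear eta m -> eta m};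
  theta : forall m, xi m -> xi m -> {linear eta m -> eta m};
  rho_smooth : @bundle_map_end R M xi eta 1 (fun m x => rho (x ord0));
  rD_smooth : @bundle_map_end R M xi eta 2
    (fun m x => rD (x ord0) (x ord_max));
  theta_smooth : @bundle_map_end R M xi eta 2
    (fun m x => theta (x ord0) (x ord_max));
  RLYB1 : forall m (a b : xi m) (v : eta m),
    rD a b v + theta a b v - theta b a v
    = (rho a (rho b v) - rho b (rho a v)) - rho (ly_br xi a b) v;
  RLYB2 : forall m (a b c : xi m) (v : eta m),
    theta a (ly_br xi b c) v - rho b (theta a c v) + rho c (theta a b v) = 0;
  RLYB3 : forall m (a b c : xi m) (v : eta m),
    theta (ly_br xi a b) c v - theta a c (rho b v) + theta b c (rho a v) = 0;
  RLYB4 : forall m (a b c d : xi m) (v : eta m),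
    theta c d (theta a b v) - theta b d (theta a c v)
    - theta a (ly_tr xi b c d) v + rD b c (theta a d v) = 0;
  RLYB5 : forall m (a b c : xi m) (v : eta m),
    rD a b (rho c v) - rho c (rD a b v) = rho (ly_tr xi a b c) v;
  RLYB6 : forall m (a b c d : xi m) (v : eta m),
    rD a b (theta c d v) - theta c d (rD a b v)
    = theta (ly_tr xi a b c) d v + theta c (ly_tr xi a b d) v }.

Arguments rho {R M xi eta} r {m} _.
Arguments rD {R M xi eta} r {m} _ _.
Arguments theta {R M xi eta} r {m} _ _.

(* Argument lists are handled as 1-based sequences X 1, X 2, ... : [seq1 x]
   turns a tuple into such a sequence, [args n X] is (X 1, ..., X n). *)
Definition seq1 (V : Type) (n : nat) (x : 'I_n.+1 -> V) : nat -> V :=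
  fun i => x (inord i.-1).

Definition args (V : Type) (n : nat) (X : nat -> V) : 'I_n -> V :=
  fun j => X j.+1.

Arguments args {V} n X _.

Definition put (V : Type) (X : nat -> V) (j : nat) (v : V) : nat -> V :=
  fun i => if i == j then v else X i.

(* omits the entries 2k-1 and 2k, for k >= 1 *)
Definition omit (V : Type) (k : nat) (X : nat -> V) : nat -> V :=
  fun i => if (i < k.*2.-1)%N then X i else X i.+2.

Definition cochains (R : realType) (M : manifold R) (xi eta : vbundle M)
    (n : nat) : set (forall m, ('I_n -> xi m) -> eta m) :=
  [set f | bundle_map f /\
     forall m (X : nat -> xi m) (i : nat), (1 <= i <= n./2)%N ->
       X i.*2.-1 = X i.*2 -> f m (args n X) = 0].

Arguments cochains {R M} xi eta n _.

Section Coboundary.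
Context (R : realType) (M : manifold R) (xi : lie_yamaguti_bundle M)
  (eta : vbundle M) (r : representation xi eta) (p : nat).

Definition deltaI
    (f : forall m, ('I_p.*2 -> xi m) -> eta m)
    (g : forall m, ('I_p.*2.+1 -> xi m) -> eta m)
    (m : M) (x : 'I_p.*2.+2 -> xi m) : eta m :=
  let X := seq1 x in
  (-1) ^+ p *:
    (rho r (X p.*2.+1) (g m (args _ (put X p.*2.+1 (X p.*2.+2))))
     - rho r (X p.*2.+2) (g m (args _ X))
     - g m (args _ (put X p.*2.+1 (ly_br xi (X p.*2.+1) (X p.*2.+2)))))
  + \sum_(1 <= k < p.+1)
      (-1) ^+ k.+1 *: rD r (X k.*2.-1) (X k.*2) (f m (args _ (omit k X)))
  + \sum_(1 <= k < p.+2) \sum_(k.*2.+1 <= j < p.*2.+3)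
      (-1) ^+ k *:
        f m (args _ (omit k (put X j (ly_tr xi (X k.*2.-1) (X k.*2) (X j))))).

Definition deltaII
    (g : forall m, ('I_p.*2.+1 -> xi m) -> eta m)
    (m : M) (x : 'I_p.*2.+3 -> xi m) : eta m :=
  let X := seq1 x in
  (-1) ^+ p *:
    (theta r (X p.*2.+2) (X p.*2.+3) (g m (args _ X))
     - theta r (X p.*2.+1) (X p.*2.+3)
         (g m (args _ (put X p.*2.+1 (X p.*2.+2)))))
  + \sum_(1 <= k < p.+2)
      (-1) ^+ k.+1 *: rD r (X k.*2.-1) (X k.*2) (g m (args _ (omit k X)))
  + \sum_(1 <= k < p.+2) \sum_(k.*2.+1 <= j < p.*2.+4)
      (-1) ^+ k *:
        g m (args _ (omit k (put X j (ly_tr xi (X k.*2.-1) (X k.*2) (X j))))).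

Definition coboundary
    (fg : (forall m, ('I_p.*2 -> xi m) -> eta m)
          * (forall m, ('I_p.*2.+1 -> xi m) -> eta m))
    : (forall m, ('I_p.+1.*2 -> xi m) -> eta m)
      * (forall m, ('I_p.+1.*2.+1 -> xi m) -> eta m) :=
  (deltaI fg.1 fg.2, deltaII fg.2).

End Coboundary.

Arguments coboundary {R M xi eta} r p fg.

(* Main.v *)
(* Cartan's formula. For a cochain F let i_{a,b} F be F with its first two
   arguments frozen to a, b, and let L_{a,b} F be D(a,b) F minus the sum over
   all slots of F with {a,b,.} inserted. Both components of the coboundary
   satisfy i_{a,b} delta = L_{a,b} - delta i_{a,b}, and this recursion reduces
   everything to cochains of lowest degree. There [L_{a,b}, delta] = 0 is
   (RLYB5), (RLYB6), (LY5), (LY6), and delta delta = 0 amounts to (RLYB2) and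
   (RLYB4); in higher degree delta delta = 0 follows by induction from
   [L_{a,b}, delta] = 0. *)

Require Import Defs.
From mathcomp Require Import all_boot all_order all_algebra.
From mathcomp Require Import all_classical all_reals all_analysis.

Set Implicit Arguments.
Unset Strict Implicit.
Unset Printing Implicit Defensive.

Import Order.TTheory GRing.Theory Num.Theory.
Import numFieldNormedType.Exports.

Local Open Scope classical_set_scope.
Local Open Scope ring_scope.

(** * Smooth functions *)

(** Cartan's recursion is taken as the definition of an auxiliary coboundary, [cob], and is matched
    with the explicit sums only afterwards. The shape of the proof is dictated by index bookkeeping:
    contraction lowers the degree by two, and with arguments indexed by ['I_n] each step would carry
    casts. Cochains are therefore functions of infinite sequences in a single fibre, and the degree
    n enters through a predicate asking for locality and linearity in the entries 1, ..., n. The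
    recursion ends at p = 0, one step below the range of the theorem, where the coboundary is that
    of a linear map. Apart from the degree of the cochain, delta_I and delta_II obey the same
    recursion and differ only in this initial value, so one boolean parameter treats both. That the
    image consists of cochains again is proved along the same recursion: multilinearity, alternation
    and smoothness all pass through i and L. *)

Section SmoothFunctions.
Context (R : realType) (n : nat).
Implicit Types (U W : set 'rV[R]_n) (f g : 'rV[R]_n -> R).

Lemma Ck_sub k U W f : U `<=` W -> Ck k W f -> Ck k U f.
Proof.
move=> UW; elim: k f => [|k IH] f /= [cf df]; split=> //; try by move=> x /UW/cf.
move=> i; have [di Di] := df i; by split=> [x /UW /di //|]; exact: IH.
Qed.

Lemma CkS k U f : Ck k.+1 U f -> Ck k U f.
Proof.
elim: k f => [|k IH] f; first by case.
move=> [cf df]; split=> // i.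
by have [di Di] := df i; split=> //; exact: IH.
Qed.

(** Since [U] is open, the two functions agree near each of its points, and continuity and
    derivatives depend only on germs. *)
Lemma Ck_eq k U f g : open U -> (forall x, U x -> f x = g x) ->
  Ck k U f -> Ck k U g.
Proof.
move=> oU; elim: k f g => [|k IH] f g fg [cf df].
all: have nearfg x : U x -> \near x, f x = g x
  by move=> Ux; apply: filterS fg _; exact: open_nbhs_nbhs.
all: have cg x : U x -> {for x, continuous g}
  by move=> Ux; rewrite /prop_for /continuous_at -(fg x Ux);
    by apply: cvg_trans (cf x Ux);
      exact: (@near_eq_cvg _ _ (nbhs x) _ _ _ (nearfg x Ux)).
all: split=> //.
move=> i; have [di Di] := df i; split=> [x Ux|].
  by apply: near_eq_derivable (di x Ux); exact: nearfg.
by apply: IH Di => x Ux; apply: near_eq_derive; exact: nearfg.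
Qed.

Lemma Ck_cst k U (c : R) : open U -> Ck k U (cst c).
Proof.
move=> oU; elim: k c => [|k IH] c; split=> //;
  try by move=> x _; exact: cst_continuous.
move=> i; split=> [x _|]; first exact: derivable_cst.
by apply: Ck_eq (IH 0) => // x _; rewrite derive_cst.
Qed.

Lemma CkD k U f g : open U -> Ck k U f -> Ck k U g -> Ck k U (f \+ g).
Proof.
move=> oU; elim: k f g => [|k IH] f g [cf df] [cg dg]; split=> //;
  try by move=> x Ux; apply: continuousD; [exact: cf|exact: cg].
move=> i; have [di Di] := df i; have [ei Ei] := dg i; split=> [x Ux|].
  by apply: derivableD; [exact: di|exact: ei].
apply: Ck_eq (IH _ _ Di Ei) => // x Ux /=.
by rewrite -deriveD //; [exact: di|exact: ei].
Qed.

Lemma CkM k U f g : open U -> Ck k U f -> Ck k U g -> Ck k U (f \* g).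
Proof.
move=> oU; elim: k f g => [|k IH] f g Cf Cg;
  have [cf df] := Cf; have [cg dg] := Cg; split=> //;
  try by move=> x Ux; apply: continuousM; [exact: cf|exact: cg].
move=> i; have [di Di] := df i; have [ei Ei] := dg i; split=> [x Ux|].
  by apply: derivableM; [exact: di|exact: ei].
apply: Ck_eq (CkD oU (IH _ _ (CkS Cf) Ei) (IH _ _ (CkS Cg) Di)) => // x Ux /=.
by rewrite -[RHS]/('D_(delta_mx 0 i) (f * g) x) deriveM //; [exact: di|exact: ei].
Qed.

End SmoothFunctions.

(** The image of [c] is open, so a point y near [c x] is [c z] for some z in the domain; continuity
    of [ch_inv] at [c x] then puts z, which is [ch_inv c y], into [U]. *)
Lemma chart_image_open (R : realType) (n : nat) (X : topologicalType)
    (c : chart R n X) (U : set X) : open U -> open (c @` (U `&` ch_dom c)).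
Proof.
move=> oU; rewrite openE => _ [x [Ux cx] <-]; rewrite /interior.
have cxI : (c @` ch_dom c) (c x) by exists x.
have oV : open (U `&` ch_dom c) by apply: openI => //; exact: ch_dom_open.
near=> y.
have [z cz zy] : (c @` ch_dom c) y.
  by near: y; apply: open_nbhs_nbhs; split => //; exact: ch_img_open.
exists z => //; rewrite -(ch_mapK cz) zy; near: y.
apply: (ch_inv_cont cxI); rewrite (ch_mapK cx).
by apply: open_nbhs_nbhs; split.
Unshelve. all: by end_near. Qed.

Section SmoothFun.
Context (R : realType) (X : manifold R) (U : set X).
Context (oU : open U).

Lemma smooth_fun_sub (V : set X) (h : X -> R) :
  V `<=` U -> smooth_fun U h -> smooth_fun V h.
Proof.
move=> VU sh c ac k; apply: Ck_sub (sh c ac k).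
by move=> _ [x [Vx cx] <-]; exists x => //; split=> //; exact: VU.
Qed.

Lemma smooth_fun_eq (h h' : X -> R) : (forall x, U x -> h x = h' x) ->
  smooth_fun U h -> smooth_fun U h'.
Proof.
move=> hh' sh c ac k; apply: Ck_eq (sh c ac k); first exact: chart_image_open.
by move=> _ [x [Ux cx] <-]; rewrite ch_mapK //; exact: hh'.
Qed.

Lemma smooth_fun_cst (a : R) : smooth_fun U (fun=> a).
Proof. by move=> c ac k; apply: Ck_cst; exact: chart_image_open. Qed.

Lemma smooth_funD (h h' : X -> R) :
  smooth_fun U h -> smooth_fun U h' -> smooth_fun U (fun x => h x + h' x).
Proof.
by move=> sh sh' c ac k; apply: (CkD _ (sh c ac k) (sh' c ac k));
  exact: chart_image_open.
Qed.

Lemma smooth_funM (h h' : X -> R) :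
  smooth_fun U h -> smooth_fun U h' -> smooth_fun U (fun x => h x * h' x).
Proof.
by move=> sh sh' c ac k; apply: (CkM _ (sh c ac k) (sh' c ac k));
  exact: chart_image_open.
Qed.

End SmoothFun.

(** * Linear identities in abelian groups *)

(* [zmod] decides linear identities in abelian groups, by comparing the integer
   coefficients of the atoms on both sides. *)
Inductive zexpr := ZAtom of nat | ZZero | ZAdd of zexpr & zexpr | ZOpp of zexpr.

Fixpoint zeval (A : zmodType) (s : seq A) (t : zexpr) : A :=
  match t with
  | ZAtom i => nth 0 s i
  | ZZero => 0
  | ZAdd t1 t2 => zeval s t1 + zeval s t2
  | ZOpp t1 => - zeval s t1
  end.

Fixpoint zcoef (t : zexpr) (i : nat) : int :=
  match t with
  | ZAtom j => (i == j : nat)%:Z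
  | ZZero => 0
  | ZAdd t1 t2 => zcoef t1 i + zcoef t2 i
  | ZOpp t1 => - zcoef t1 i
  end.

Lemma zeval_coef (A : zmodType) (s : seq A) t :
  zeval s t = \sum_(i < size s) s`_i *~ zcoef t i.
Proof.
elim: t => [j||t1 IH1 t2 IH2|t IH] /=.
- have [sj|js] := leqP (size s) j.
    rewrite nth_default // big1 // => i _.
    by rewrite (ltn_eqF (leq_trans (ltn_ord i) sj)).
  rewrite (bigD1 (Ordinal js)) //= eqxx big1 ?addr0 // => i.
  by rewrite -val_eqE /= => /negPf ->.
- by rewrite big1.
- by rewrite IH1 IH2 -big_split; apply: eq_bigr => i _; rewrite mulrzDr.
- by rewrite IH -sumrN; apply: eq_bigr => i _; rewrite mulrNz.
Qed.

Lemma zeval_eq (A : zmodType) (s : seq A) t1 t2 :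
  all (fun i => zcoef t1 i == zcoef t2 i) (iota 0 (size s)) ->
  zeval s t1 = zeval s t2.
Proof.
move=> /allP t12; rewrite !zeval_coef; apply: eq_bigr => i _.
by rewrite (eqP (t12 _ _)) // mem_iota ltn_ord.
Qed.

(* Atoms are compared up to conversion, as rewriting with [bigop] lemmas leaves
   sums that differ in their implicit arguments. *)
Ltac zmod_index x s :=
  match s with
  | ?y :: _ => let _ := constr:(erefl : x = y) in constr:(0%N)
  | _ :: ?s' => let i := zmod_index x s' in constr:(i.+1)
  end.

Ltac zmod_atoms s t :=
  lazymatch t with
  | @GRing.add _ ?t1 ?t2 => let s' := zmod_atoms s t1 in zmod_atoms s' t2
  | @GRing.opp _ ?t1 => zmod_atoms s t1
  | @GRing.zero _ => s
  | _ => match s with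
         | _ => let i := zmod_index t s in s
         | _ => constr:(t :: s)
         end
  end.

Ltac zmod_reify s t :=
  lazymatch t with
  | @GRing.add _ ?t1 ?t2 => let e1 := zmod_reify s t1 in
      let e2 := zmod_reify s t2 in constr:(ZAdd e1 e2)
  | @GRing.opp _ ?t1 => let e1 := zmod_reify s t1 in constr:(ZOpp e1)
  | @GRing.zero _ => constr:(ZZero)
  | _ => let i := zmod_index t s in constr:(ZAtom i)
  end.

Ltac zmod :=
  lazymatch goal with
  | |- @eq ?A ?t1 ?t2 =>
      let s1 := zmod_atoms (@nil A) t1 in
      let s := zmod_atoms s1 t2 in
      let e1 := zmod_reify s t1 in
      let e2 := zmod_reify s t2 in
      apply: (@zeval_eq _ s e1 e2); vm_compute; reflexivity
  end.

Section LinearPred.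
Context (R : realType) (U U' : lmodType R) (h : U -> U') (lh : linear h).

Lemma linear_add x y : h (x + y) = h x + h y.
Proof. by have := lh 1 x y; rewrite !scale1r. Qed.

Lemma linear_zero : h 0 = 0.
Proof. by have := lh (-1) 0 0; rewrite scaler0 addr0 scaleN1r addNr. Qed.

Lemma linear_scale k x : h (k *: x) = k *: h x.
Proof. by have := lh k x 0; rewrite !addr0 linear_zero addr0. Qed.

End LinearPred.

(** * Sequences of arguments *)

Section Streams.
Context (V : Type).
Implicit Types (X : nat -> V) (a b u : V).

(* Arguments start at index 1; the unused entry 0 of [X] is kept at index 0, so
   that [cons2_eta] is an equality of functions. *)
Definition cons2 a b X : nat -> V :=
  fun i => if i is i'.+1 then
    (if i' is i''.+1 then (if i'' is k.+1 then X k.+1 else b) else a)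
  else X 0.

Lemma cons2_eta X : cons2 (X 1) (X 2) (omit 1 X) = X.
Proof. by apply/funext => -[|[|[|i]]]. Qed.

Lemma cons2P X : exists a b Y, X = cons2 a b Y.
Proof. by exists (X 1), (X 2), (omit 1 X); rewrite cons2_eta. Qed.

Lemma omit1_cons2 a b X : omit 1 (cons2 a b X) = X.
Proof. by apply/funext => -[|[|i]]. Qed.

Lemma omitS_cons2 k a b X : omit k.+2 (cons2 a b X) = cons2 a b (omit k.+1 X).
Proof. by apply/funext => -[|[|[|i]]]; rewrite /omit /= ?doubleS. Qed.

Lemma put1_cons2 a b X u : put (cons2 a b X) 1 u = cons2 u b X.
Proof. by apply/funext => -[|[|[|i]]]. Qed.

Lemma put2_cons2 a b X u : put (cons2 a b X) 2 u = cons2 a u X.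
Proof. by apply/funext => -[|[|[|i]]]. Qed.

Lemma put_cons2 j a b X u :
  put (cons2 a b X) j.+3 u = cons2 a b (put X j.+1 u).
Proof. by apply/funext => -[|[|[|i]]]. Qed.

Lemma putC X i j a b :
  i != j -> put (put X i a) j b = put (put X j b) i a.
Proof.
move=> ij; apply/funext => k; rewrite /put.
by case: (eqVneq k j) => // ->; rewrite eq_sym (negPf ij).
Qed.

Lemma put_put X i a b : put (put X i a) i b = put X i b.
Proof. by apply/funext => k; rewrite /put; case: eqP. Qed.

Lemma put_id X i : put X i (X i) = X.
Proof. by apply/funext => k; rewrite /put; case: eqP => [->|]. Qed.

Lemma put_same X i a : put X i a i = a.
Proof. by rewrite /put eqxx. Qed.

Lemma put_diff X i j a : j != i -> put X i a j = X j.
Proof. by rewrite /put => /negPf ->. Qed.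

End Streams.

(** * Representations in a single fibre *)

Record ly_rep (R : realType) (V W : lmodType R) (br : V -> V -> V)
    (tr : V -> V -> V -> V) := LYRep {
  frho : V -> {linear W -> W};
  fD : V -> V -> {linear W -> W};
  ftheta : V -> V -> {linear W -> W};
  frho_linear : forall w, linear (fun a => frho a w);
  fD_linearl : forall b w, linear (fun a => fD a b w);
  fD_linearr : forall a w, linear (fun b => fD a b w);
  ftheta_linearl : forall b w, linear (fun a => ftheta a b w);
  ftheta_linearr : forall a w, linear (fun b => ftheta a b w);
  rep1 : forall a b w, fD a b w + ftheta a b w - ftheta b a w
    = (frho a (frho b w) - frho b (frho a w)) - frho (br a b) w;
  rep2 : forall a b c w,
    ftheta a (br b c) w - frho b (ftheta a c w) + frho c (ftheta a b w) = 0;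
  rep4 : forall a b c d w,
    ftheta c d (ftheta a b w) - ftheta b d (ftheta a c w)
    - ftheta a (tr b c d) w + fD b c (ftheta a d w) = 0;
  rep5 : forall a b c w,
    fD a b (frho c w) - frho c (fD a b w) = frho (tr a b c) w;
  rep6 : forall a b c d w,
    fD a b (ftheta c d w) - ftheta c d (fD a b w)
    = ftheta (tr a b c) d w + ftheta c (tr a b d) w }.

Section Fibre.
Context (R : realType) (V W : lmodType R) (br : V -> V -> V)
  (tr : V -> V -> V -> V) (LY : is_lie_yamaguti br tr) (rep : ly_rep W br tr).

Local Notation rho := (frho rep).
Local Notation D := (fD rep).
Local Notation theta := (ftheta rep).

Implicit Types (F G : (nat -> V) -> W) (X Y : nat -> V) (a b c d u v : V).
Implicit Types (w : W) (e : bool).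

Lemma rD_br a b w :
  D a b w = (rho a (rho b w) - rho b (rho a w)) - rho (br a b) w
            - theta a b w + theta b a w.
Proof. by rewrite -rep1; zmod. Qed.

Lemma br_xx a : br a a = 0.
Proof.
have /eqP := LY1 LY a a.
by rewrite -addr_eq0 -mulr2n -scaler_nat scaler_eq0 pnatr_eq0 /= => /eqP.
Qed.

Lemma tr_xx a b : tr a a b = 0.
Proof.
have /eqP := LY2 LY a a b.
by rewrite -addr_eq0 -mulr2n -scaler_nat scaler_eq0 pnatr_eq0 /= => /eqP.
Qed.

Lemma rho0 w : rho 0 w = 0.
Proof. exact: (linear_zero (frho_linear rep w)). Qed.

(** Alternation of D is not an axiom: it follows from (RLYB1), whose remaining terms together are
    skew in the two arguments. *)
Lemma rD_xx a w : D a a w = 0.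
Proof. by rewrite rD_br br_xx rho0 !subrr sub0r addNr. Qed.

Lemma rD_rho a b c w : D a b (rho c w) = rho c (D a b w) + rho (tr a b c) w.
Proof. by rewrite -rep5; zmod. Qed.

Lemma rD_theta a b c d w :
  D a b (theta c d w)
  = theta c d (D a b w) + theta (tr a b c) d w + theta c (tr a b d) w.
Proof. by rewrite -addrA -rep6; zmod. Qed.

Lemma rhoD a b w : rho (a + b) w = rho a w + rho b w.
Proof. exact: (linear_add (frho_linear rep w)). Qed.

(* Specialised to [{linear W -> W}]: after [linearB] the head of the function
   is no longer syntactically that of [rho], [D] or [theta]. *)
Lemma endB (h : {linear W -> W}) w w' : h (w - w') = h w - h w'.
Proof. exact: linearB. Qed.

Lemma endD (h : {linear W -> W}) w w' : h (w + w') = h w + h w'.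
Proof. exact: linearD. Qed.

(* [D(c,d)] is expressed through [rho] and [theta] by (RLYB1), and [D(a,b)]
   acts on those by derivations. *)
Lemma rD_rD a b c d w :
  D a b (D c d w) = D c d (D a b w) + D (tr a b c) d w + D c (tr a b d) w.
Proof.
rewrite !(rD_br c, rD_br (tr a b c)) !(endB, endD) /= !(rD_rho, rD_theta).
rewrite (LY5 LY) rhoD !(endB, endD) /=.
zmod.
Qed.

(** * The operators L and the coboundary in one fibre *)

(* Locality is needed because [F] is a function of the whole sequence. *)
Definition mlin n F :=
  (forall X Y, (forall i, (0 < i <= n)%N -> X i = Y i) -> F X = F Y) /\
  (forall i X, (0 < i <= n)%N -> linear (fun u => F (put X i u))).

Definition pair_alternating p F := forall X i, (i < p)%N ->
  X i.*2.+1 = X i.*2.+2 -> F X = 0.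

(** The contraction i_{a,b}. *)
Definition contract2 F a b : (nat -> V) -> W := fun X => F (cons2 a b X).

Definition lieder n a b F : (nat -> V) -> W := fun X =>
  D a b (F X) - \sum_(0 <= j < n) F (put X j.+1 (tr a b (X j.+1))).

Lemma mlin_put n F i X k u v : mlin n F -> (0 < i <= n)%N ->
  F (put X i (k *: u + v)) = k *: F (put X i u) + F (put X i v).
Proof. by case=> _ lF ni; exact: (lF i X ni). Qed.

Lemma mlin_putD n F i X u v : mlin n F -> (0 < i <= n)%N ->
  F (put X i (u + v)) = F (put X i u) + F (put X i v).
Proof. by case=> _ lF ni; exact: (linear_add (lF i X ni)). Qed.

Lemma mlin_put0 n F i X : mlin n F -> (0 < i <= n)%N -> F (put X i 0) = 0.
Proof. by case=> _ lF ni; exact: (linear_zero (lF i X ni)). Qed.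

Lemma mlin_contract2 n F a b : mlin n.+2 F -> mlin n (contract2 F a b).
Proof.
case=> eF lF; split=> [X Y XY|[//|i] X ni k u v]; rewrite /contract2.
  by apply: eF => -[|[|[|i]]] //= ni; exact: XY.
by rewrite -!put_cons2; exact: lF.
Qed.

Lemma lieder_cons2 n a b F c d X :
  lieder n.+2 a b F (cons2 c d X)
  = lieder n a b (contract2 F c d) X - F (cons2 (tr a b c) d X)
    - F (cons2 c (tr a b d) X).
Proof.
rewrite /lieder !big_nat_recl // put1_cons2 put2_cons2 /contract2.
rewrite (eq_bigr (fun j => F (cons2 c d (put X j.+1 (tr a b (X j.+1)))))) /=.
  by rewrite !opprD !addrA; zmod.
by move=> j _; rewrite put_cons2.
Qed.

(** Cartan's relation [L_{a,b}, i_{c,d}] = i_{{a,b,c},d} + i_{c,{a,b,d}}: the subtracted terms are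
    the insertions into the two frozen slots. *)
Lemma contract2_lieder n a b F c d :
  contract2 (lieder n.+2 a b F) c d
  = (lieder n a b (contract2 F c d) \- contract2 F (tr a b c) d)
    \- contract2 F c (tr a b d).
Proof. by apply/funext => X; rewrite /contract2 lieder_cons2. Qed.

Lemma lieder_lin n a b k F G :
  lieder n a b (fun X => k *: F X + G X)
  = (fun X => k *: lieder n a b F X + lieder n a b G X).
Proof.
apply/funext => X; rewrite /lieder linearP big_split /= -scaler_sumr scalerBr.
by rewrite opprD addrACA.
Qed.

Lemma fun_sub_lin F G : F \- G = (fun X => (-1) *: G X + F X).
Proof. by apply/funext => X /=; rewrite scaleN1r addrC. Qed.

Lemma lieder_sub n a b F G X :
  lieder n a b (F \- G) X = lieder n a b F X - lieder n a b G X.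
Proof. by rewrite fun_sub_lin lieder_lin scaleN1r addrC. Qed.

Lemma mlin_lieder n a b F : mlin n F -> mlin n (lieder n a b F).
Proof.
move=> mF; have [eF lF] := mF; split=> [X Y XY|i X ni k u v].
  rewrite /lieder (eF X Y XY) big_nat [in RHS]big_nat; congr (_ - _).
  apply: eq_bigr => j /= jn; apply: eF => i ni; rewrite /put.
  by rewrite (XY j.+1) // (XY i ni).
rewrite /lieder (mlin_put _ _ _ _ mF ni) linearP.
rewrite scalerBr scaler_sumr addrACA -opprD -big_split /=; congr (_ - _).
rewrite big_nat [RHS]big_nat; apply: eq_bigr => j jn.
have [->|ij] := eqVneq i j.+1.
  rewrite !put_same !put_put (linear_add (LY_tr_linear3 LY a b)).
  by rewrite (linear_scale (LY_tr_linear3 LY a b)) (mlin_put _ _ _ _ mF).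
rewrite !put_diff 1?eq_sym // ![put (put X i _) _ _]putC //.
by rewrite (mlin_put _ _ _ _ mF ni).
Qed.

(* Off the diagonal the double sum is symmetric; the diagonal gives (LY6). *)
Lemma lieder_lieder n a b c d F X : mlin n F ->
  lieder n a b (lieder n c d F) X
  = lieder n c d (lieder n a b F) X + lieder n (tr a b c) d F X
    + lieder n c (tr a b d) F X.
Proof.
move=> mF; rewrite /lieder (endB (D a b)) (endB (D c d)) rD_rD.
rewrite (linear_sum (D a b)) (linear_sum (D c d)) /= !sumrB.
set S1 := \sum_(0 <= j < n) D c d _; set S2 := \sum_(0 <= j < n) D a b _.
set T1 := \sum_(0 <= j < n) \sum_(0 <= i < n) _.
set T2 := \sum_(0 <= j < n) \sum_(0 <= i < n) _.
set U1 := \sum_(0 <= j < n) F _; set U2 := \sum_(0 <= j < n) F _.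
suff -> : T1 = T2 - U1 - U2 by zmod.
rewrite /T2 exchange_big_nat /= /T1 /U1 /U2 -!sumrB.
rewrite big_nat [RHS]big_nat; apply: eq_bigr => i ni.
have E j : j != i -> F (put (put X i.+1 (tr a b (X i.+1))) j.+1
      (tr c d (put X i.+1 (tr a b (X i.+1)) j.+1)))
    = F (put (put X j.+1 (tr c d (X j.+1))) i.+1
      (tr a b (put X j.+1 (tr c d (X j.+1)) i.+1))).
  by move=> ji; have ij : i != j; [rewrite eq_sym|rewrite !put_diff ?eqSS // putC].
rewrite (bigD1_seq i) ?mem_index_iota ?iota_uniq //=.
rewrite [in RHS](bigD1_seq i) ?mem_index_iota ?iota_uniq //=.
rewrite (eq_bigr _ (fun j ji => E j ji)) !put_same !put_put (LY6 LY a b c d).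
by rewrite !(mlin_putD _ _ _ mF) //; zmod.
Qed.

(** The formulas for delta_I and delta_II read at p = 0: they measure how far a linear map g is from
    being a derivation of the binary and of the ternary operation with values in W. *)
Definition base e (g : V -> W) : (nat -> V) -> W := fun X =>
  if e then theta (X 2) (X 3) (g (X 1)) - theta (X 1) (X 3) (g (X 2))
            + D (X 1) (X 2) (g (X 3)) - g (tr (X 1) (X 2) (X 3))
  else rho (X 1) (g (X 2)) - rho (X 2) (g (X 1)) - g (br (X 1) (X 2)).

(* [e = false] gives [delta_I] and [e = true], with [F = G], gives [delta_II];
   the cochains have degrees [2p+e] and [2p+1]. The recursion is Cartan's
   formula [i_x d + d i_x = L_x]. *)
Fixpoint cob e p F G : (nat -> V) -> W := fun X =>
  if p is p'.+1 then
    lieder (p.*2 + e) (X 1) (X 2) F (omit 1 X)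
    - cob e p' (contract2 F (X 1) (X 2)) (contract2 G (X 1) (X 2)) (omit 1 X)
  else base e (fun u => G (fun=> u)) X.

Lemma cobS e p F G a b X :
  cob e p.+1 F G (cons2 a b X)
  = lieder (p.+1.*2 + e) a b F X - cob e p (contract2 F a b) (contract2 G a b) X.
Proof. by rewrite /= omit1_cons2. Qed.

Lemma contract2_cob e p F G a b :
  contract2 (cob e p.+1 F G) a b
  = lieder (p.+1.*2 + e) a b F \- cob e p (contract2 F a b) (contract2 G a b).
Proof. by apply/funext => X; rewrite /contract2 cobS. Qed.

Lemma base_lin e k (g g' : V -> W) X :
  base e (fun u => k *: g u + g' u) X = k *: base e g X + base e g' X.
Proof.
rewrite /base; case: e; rewrite !linearP /= !(scalerBr, scalerDr) ?scalerN.
  by zmod.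
by zmod.
Qed.

Lemma cob_lin e p k F F' G G' X :
  cob e p (fun Y => k *: F Y + F' Y) (fun Y => k *: G Y + G' Y) X
  = k *: cob e p F G X + cob e p F' G' X.
Proof.
elim: p F F' G G' X => [|p IH] F F' G G' X; first exact: base_lin.
by rewrite /= lieder_lin IH scalerBr; zmod.
Qed.

Lemma cob_sub e p F F' G G' X :
  cob e p (F \- F') (G \- G') X = cob e p F G X - cob e p F' G' X.
Proof. by rewrite !fun_sub_lin cob_lin scaleN1r addrC. Qed.

(** By locality a cochain of degree 1 sees only entry 1, so a constant sequence serves to feed it a
    single vector. *)
Lemma mlin1_linear G : mlin 1 G -> linear (fun u => G (fun=> u)).
Proof.
move=> mG k u v; have [eG _] := mG.
have E x : G (fun=> x) = G (put (fun=> 0) 1 x).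
  by apply: eG => -[|[|i]].
by rewrite !E (mlin_put _ _ _ _ mG).
Qed.

Lemma lieder1 a b G u : mlin 1 G ->
  lieder 1 a b G (fun=> u) = D a b (G (fun=> u)) - G (fun=> tr a b u).
Proof.
case=> eG _; rewrite /lieder big_nat1; congr (_ - _).
by apply: eG => -[|[|i]].
Qed.

(** D(a,b) acts as a derivation on every ingredient of [base]. For [e = true] the term D(x1,x2)g(x3)
    also requires that D acts on D by derivations, which is [rD_rD]. *)
Lemma lieder_base e a b G X : mlin 1 G ->
  lieder (2 + e) a b (base e (fun u => G (fun=> u))) X
  = base e (fun u => lieder 1 a b G (fun=> u)) X.
Proof.
move=> mG.
have gD u v : G (fun=> u + v) = G (fun=> u) + G (fun=> v).
  exact: (linear_add (mlin1_linear mG)).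
have -> : (fun u => lieder 1 a b G (fun=> u))
    = (fun u => D a b (G (fun=> u)) - G (fun=> tr a b u)).
  by apply/funext => u; exact: lieder1.
rewrite /lieder /base.
case: e; rewrite !big_nat_recl // big_geq // /put /=.
  rewrite !(endB (D a b), endD (D a b)) !(rD_theta, rD_rD a b).
  rewrite (LY6 LY a b) !gD !(endB (theta _ _), endB (D _ _)).
  by zmod.
rewrite !(endB (D a b), endD (D a b)) !rD_rho (LY5 LY) gD.
by rewrite !(endB (rho _)); zmod.
Qed.

(** Contract both sides with c, d. The contractions along {a,b,c} and {a,b,d} under delta cancel,
    the induction hypothesis moves L past delta on the contracted cochains, and what is left is the
    commutation rule [lieder_lieder] applied to F. *)
Lemma lieder_cob e p a b F G X : mlin (p.*2 + e) F -> mlin p.*2.+1 G ->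
  lieder (p.+1.*2 + e) a b (cob e p F G) X
  = cob e p (lieder (p.*2 + e) a b F) (lieder p.*2.+1 a b G) X.
Proof.
elim: p F G X => [|p IH] F G X mF mG; first exact: lieder_base.
have [c [d [Y ->]]] := cons2P X.
rewrite lieder_cons2 contract2_cob lieder_sub !cobS !contract2_lieder 2!cob_sub.
rewrite (IH _ _ _ (mlin_contract2 _ _ mF) (mlin_contract2 _ _ mG)).
by rewrite (lieder_lieder a b _ _ _ mF); zmod.
Qed.

(** Writing i and L for i_{a,b} and L_{a,b}, the step is i delta delta = L delta - delta (L - delta
    i) = delta delta i, by Cartan's formula used twice and [L, delta] = 0. *)
Lemma cob_cob e p F G X : mlin (p.*2 + e) F -> mlin p.*2.+1 G ->
  cob e p.+1 (cob e p F G) (cob true p G G) X = 0.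
Proof.
elim: p F G X => [|p IH] F G X mF mG; have [a [b [Y ->]]] := cons2P X.
  rewrite cobS lieder_cob //=.
  (* At p = 0 Cartan's formula fails for delta_II G: its contraction is L_{a,b} G plus the
     correction [h], so only [base e h] survives. *)
  pose h u := theta b u (G (fun=> a)) - theta a u (G (fun=> b)).
  have -> : (fun u => contract2 (base true (fun v => G (fun=> v))) a b (fun=> u))
          = (fun u => 1 *: lieder 1 a b G (fun=> u) + h u).
    apply/funext => u; rewrite scale1r /h lieder1 // /contract2 /base /=.
    by zmod.
  rewrite base_lin scale1r; suff -> : base e h Y = 0 by zmod.
  rewrite /base /h; case: e {mF}.
    rewrite !(endB (theta _ _), endB (D _ _)).
    (* The parts of [base e h] containing G(a) and G(b) are, up to sign, instances of one axiom
       each. Substituting them for the zeros of [0 - 0] leaves a purely additive identity. *)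
    have := rep4 rep b (Y 1) (Y 2) (Y 3) (G (fun=> a)).
    have := rep4 rep a (Y 1) (Y 2) (Y 3) (G (fun=> b)).
    by move=> E1 E2; rewrite -[RHS](subrr 0) -{1}E2 -E1; zmod.
  rewrite !(endB (rho _)).
  have := rep2 rep b (Y 1) (Y 2) (G (fun=> a)).
  have := rep2 rep a (Y 1) (Y 2) (G (fun=> b)).
  by move=> E1 E2; rewrite -[RHS](subrr 0) -{1}E1 -E2; zmod.
rewrite cobS lieder_cob // !contract2_cob cob_sub.
rewrite (IH _ _ _ (mlin_contract2 _ _ mF) (mlin_contract2 _ _ mG)).
by rewrite addn1; zmod.
Qed.

(** * Multilinearity and alternation of the coboundary *)

Lemma lieder_linearl n b F X : mlin n F -> linear (fun a => lieder n a b F X).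
Proof.
move=> mF k a a'; rewrite /lieder fD_linearl scalerBr scaler_sumr addrACA -opprD.
rewrite -big_split /=; congr (_ - _); rewrite big_nat [RHS]big_nat.
by apply: eq_bigr => j jn; rewrite (LY_tr_linear1 LY) (mlin_put _ _ _ _ mF).
Qed.

Lemma lieder_linearr n a F X : mlin n F -> linear (fun b => lieder n a b F X).
Proof.
move=> mF k b b'; rewrite /lieder fD_linearr scalerBr scaler_sumr addrACA -opprD.
rewrite -big_split /=; congr (_ - _); rewrite big_nat [RHS]big_nat.
by apply: eq_bigr => j jn; rewrite (LY_tr_linear2 LY) (mlin_put _ _ _ _ mF).
Qed.

Lemma contract2_linearl n F b k a a' : mlin n.+1 F ->
  contract2 F (k *: a + a') b
  = (fun X => k *: contract2 F a b X + contract2 F a' b X).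
Proof.
move=> mF; apply/funext => X; rewrite /contract2 -(put1_cons2 0 b X).
by rewrite (mlin_put _ _ _ _ mF) // !put1_cons2.
Qed.

Lemma contract2_linearr n F a k b b' : mlin n.+2 F ->
  contract2 F a (k *: b + b')
  = (fun X => k *: contract2 F a b X + contract2 F a b' X).
Proof.
move=> mF; apply/funext => X; rewrite /contract2 -(put2_cons2 a 0 X).
by rewrite (mlin_put _ _ _ _ mF) // !put2_cons2.
Qed.

Lemma mlin_base e (g : V -> W) : linear g -> mlin (2 + e) (base e g).
Proof.
move=> lg; have lg' k u v : g (k *: u + v) = k *: g u + g v by exact: lg.
split=> [X Y XY|i X ni k u v]; rewrite /base.
  by case: e XY => XY; rewrite !XY.
case: e ni; case: i => [|[|[|[|i]]]] //= _; rewrite /put /=.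
- rewrite ftheta_linearl fD_linearl (LY_tr_linear1 LY) !lg' !linearP /=.
  by rewrite !(scalerBr, scalerDr) ?scalerN; zmod.
- rewrite ftheta_linearl fD_linearr (LY_tr_linear2 LY) !lg' !linearP /=.
  by rewrite !(scalerBr, scalerDr) ?scalerN; zmod.
- rewrite !ftheta_linearr (LY_tr_linear3 LY) !lg' !linearP /=.
  by rewrite !(scalerBr, scalerDr) ?scalerN; zmod.
- rewrite frho_linear (LY_br_linearl LY) !lg' !linearP /=.
  by rewrite !(scalerBr, scalerDr) ?scalerN; zmod.
- rewrite frho_linear (LY_br_linearr LY) !lg' !linearP /=.
  by rewrite !(scalerBr, scalerDr) ?scalerN; zmod.
Qed.

(** Slots 1 and 2 enter the recursion as the parameters a, b of L_{a,b} and i_{a,b}, so linearity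
    there is linearity of these operators in a and b. Later slots are handled by the induction
    hypothesis and [mlin_lieder]. *)
Lemma mlin_cob e p F G : mlin (p.*2 + e) F -> mlin p.*2.+1 G ->
  mlin (p.+1.*2 + e) (cob e p F G).
Proof.
elim: p F G => [|p IH] F G mF mG; first exact: mlin_base (mlin1_linear mG).
have mcF a b := mlin_contract2 a b mF; have mcG a b := mlin_contract2 a b mG.
split=> [X Y XY /=|i X].
  rewrite (XY 1) // (XY 2) //.
  have oXY j : (0 < j <= p.+1.*2 + e)%N -> omit 1 X j = omit 1 Y j.
    by case: j => // j nj; exact: (XY j.+3).
  rewrite ((mlin_lieder _ _ mF).1 _ _ oXY).
  by rewrite ((IH _ _ (mcF _ _) (mcG _ _)).1 _ _ oXY).
have [a [b [Y ->]]] := cons2P X; case: i => [|[|[|i]]] // ni k u v.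
- rewrite !put1_cons2 !cobS lieder_linearl // (contract2_linearl _ _ _ _ mF).
  by rewrite (contract2_linearl _ _ _ _ mG) cob_lin scalerBr; zmod.
- rewrite !put2_cons2 !cobS lieder_linearr // (contract2_linearr _ _ _ _ mF).
  by rewrite (contract2_linearr _ _ _ _ mG) cob_lin scalerBr; zmod.
rewrite !put_cons2 !cobS (mlin_put _ _ _ _ (mlin_lieder _ _ mF)) //.
by rewrite (mlin_put _ _ _ _ (IH _ _ (mcF a b) (mcG a b))) // scalerBr; zmod.
Qed.

Lemma pair_alternating_contract2 p F a b :
  pair_alternating p.+1 F -> pair_alternating p (contract2 F a b).
Proof. by move=> aF X i ip Xi; apply: (aF (cons2 a b X) i.+1). Qed.

Lemma pair_alternating_contract2_xx p F a : pair_alternating p.+1 F ->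
  contract2 F a a = (fun=> 0).
Proof. by move=> aF; apply/funext => X; apply: (aF _ 0). Qed.

(* A slot change outside the equal pair keeps it; the two changes inside the
   pair cancel by polarization. *)
Lemma pair_alternating_lieder n p a b F : (p.*2 <= n)%N -> mlin n F ->
  pair_alternating p F -> pair_alternating p (lieder n a b F).
Proof.
move=> pn mF aF X i ip Xi; rewrite /lieder (aF X i ip Xi) raddf0 sub0r.
have i1n : (i.*2.+1 < n)%N by apply: leq_trans pn; rewrite -doubleS leq_double.
apply/eqP; rewrite oppr_eq0; apply/eqP.
rewrite big_mkord (bigD1 (Ordinal (ltnW i1n))) //=.
rewrite (bigD1 (Ordinal i1n)) /=; last first.
  by rewrite -val_eqE /= neq_ltn ltnSn orbT.
rewrite big1 ?addr0 /=; last first.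
  move=> j /andP[]; rewrite -!val_eqE /= => ji ji1; apply: (aF _ i ip).
  by rewrite !put_diff ?eqSS // eq_sym.
rewrite -Xi; set x := X i.*2.+1; set t := tr a b x.
have ex : put X i.*2.+1 x = X by rewrite put_id.
have ex' : put X i.*2.+2 x = X by rewrite /x Xi put_id.
have dij : i.*2.+1 != i.*2.+2 by rewrite neq_ltn ltnSn.
have := aF (put (put X i.*2.+1 (x + t)) i.*2.+2 (x + t)) i ip.
rewrite put_same put_diff // put_same => /(_ erefl).
have Dl z : F (put (put X i.*2.+1 (x + t)) i.*2.+2 z)
    = F (put X i.*2.+2 z) + F (put (put X i.*2.+1 t) i.*2.+2 z).
  rewrite (putC _ _ _ dij) (mlin_putD _ _ _ mF) ?(ltnW i1n) //.
  by rewrite -!(putC _ _ _ dij) ex.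
rewrite (mlin_putD _ _ _ mF) // !Dl (putC _ _ _ dij) ex' (aF X i ip Xi) add0r.
rewrite (aF (put (put X i.*2.+1 t) i.*2.+2 t) i ip) ?addr0 //.
by rewrite put_same put_diff // put_same.
Qed.

Lemma cob0 e p X : cob e p (fun=> 0) (fun=> 0) X = 0.
Proof.
pose z : (nat -> V) -> W := fun=> 0.
have E : z = z \- z by apply/funext => Y /=; rewrite subrr.
by rewrite -/z E cob_sub subrr.
Qed.

(** If the first pair is equal, then i_{a,a} kills F and G, and L_{a,a} = 0 because D(a,a) = 0 and
    {a,a,.} = 0. An equal later pair survives contraction and is respected by L. *)
Lemma pair_alternating_cob e p F G : mlin (p.*2 + e) F -> mlin p.*2.+1 G ->
  pair_alternating p F -> pair_alternating p G ->
  pair_alternating p.+1 (cob e p F G).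
Proof.
elim: p F G => [|p IH] F G mF mG aF aG X i ip Xi.
  case: i ip Xi => // _ /= X12; rewrite /base /= -!X12.
  case: e {mF}; rewrite ?rD_xx ?tr_xx ?br_xx subrr.
    by rewrite (linear_zero (mlin1_linear mG)) subr0 addr0.
  by rewrite (linear_zero (mlin1_linear mG)) subr0.
have [a [b [Y eX]]] := cons2P X; rewrite eX in Xi *; rewrite cobS.
case: i ip Xi => [_ /= <-|i ip Xi]; last have Yi : Y i.*2.+1 = Y i.*2.+2 := Xi.
  rewrite (pair_alternating_contract2_xx _ aF).
  rewrite (pair_alternating_contract2_xx _ aG) cob0.
  rewrite /lieder rD_xx big_nat big1 ?subr0 // => j jn.
  by rewrite tr_xx (mlin_put0 _ mF).
rewrite (IH _ _ (mlin_contract2 a b mF) (mlin_contract2 a b mG)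
  (pair_alternating_contract2 a b aF) (pair_alternating_contract2 a b aG) Y i) //.
by rewrite (pair_alternating_lieder a b (leq_addr e _) mF aF _ Yi) ?subr0.
Qed.

(** * The recursion agrees with the explicit formulas *)

Definition sumD n F X :=
  \sum_(1 <= k < n.+1) (-1) ^+ k.+1 *: D (X k.*2.-1) (X k.*2) (F (omit k X)).

Definition sumT q n F X :=
  \sum_(1 <= k < q.+1) \sum_(k.*2.+1 <= j < n.+1)
    (-1) ^+ k *: F (omit k (put X j (tr (X k.*2.-1) (X k.*2) (X j)))).

(** The term k = 1 is the D-part of L_{a,b}. Shifting k by one in the other terms flips each sign,
    which accounts for the minus sign in Cartan's recursion. *)
Lemma sumD_cons2 n F a b X :
  sumD n.+1 F (cons2 a b X) = D a b (F X) - sumD n (contract2 F a b) X.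
Proof.
rewrite /sumD big_add1 big_nat_recl //= omit1_cons2 sqrrN expr1n scale1r.
rewrite big_add1 /= -sumrN; congr (_ + _); apply: eq_bigr => k _.
by rewrite omitS_cons2 [_ ^+ k.+3]exprS mulN1r scaleNr.
Qed.

Lemma sumT_cons2 q n F a b X :
  sumT q.+1 n.+2 F (cons2 a b X)
  = - \sum_(0 <= j < n) F (put X j.+1 (tr a b (X j.+1)))
    - sumT q n (contract2 F a b) X.
Proof.
rewrite /sumT big_add1 big_nat_recl //=; congr (_ + _).
  rewrite 3!big_add1 /= -sumrN; apply: eq_bigr => j _.
  by rewrite put_cons2 omit1_cons2 expr1 scaleN1r.
rewrite big_add1 /= -sumrN; apply: eq_bigr => k _.
rewrite -sumrN 3![in LHS]big_add1 [in RHS]big_add1 /=; apply: eq_bigr => j _.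
by rewrite put_cons2 omitS_cons2 [_ ^+ k.+2]exprS mulN1r scaleNr.
Qed.

(** The terms with rho and the bracket touch only the last two slots, so contracting the first two
    merely reindexes them; the minus signs of the p recursion steps accumulate to (-1)^p. *)
Lemma cob_deltaI p F G X : mlin p.*2.+1 G ->
  cob false p F G X
  = (-1) ^+ p *:
      (rho (X p.*2.+1) (G (put X p.*2.+1 (X p.*2.+2)))
       - rho (X p.*2.+2) (G X)
       - G (put X p.*2.+1 (br (X p.*2.+1) (X p.*2.+2))))
    + sumD p F X + sumT p.+1 p.*2.+2 F X.
Proof.
elim: p F G X => [|p IH] F G X mG; have [a [b [Y ->]]] := cons2P X.
  rewrite /sumD /sumT big_geq // big_nat1 big_geq // !addr0 expr0 scale1r.
  have E x Z : Z 1 = x -> G (fun=> x) = G Z.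
    by move=> <-; apply: mG.1 => -[|[|]].
  by rewrite /= /base (E b (put (cons2 a b Y) 1 b)) // (E a (cons2 a b Y)) //
    (E (br a b) (put (cons2 a b Y) 1 (br a b))).
rewrite cobS IH ?sumD_cons2 ?sumT_cons2; last exact: mlin_contract2.
rewrite /lieder addn0 /contract2 /= !doubleS !put_cons2 exprS mulN1r scaleNr.
by zmod.
Qed.

(** The D-term and the ternary term of [base] are the summands k = 1 at p = 0; after p steps of the
    recursion they have become the summands k = p+1. *)
Lemma cob_deltaII p G X : mlin p.*2.+1 G ->
  cob true p G G X
  = (-1) ^+ p *:
      (theta (X p.*2.+2) (X p.*2.+3) (G X)
       - theta (X p.*2.+1) (X p.*2.+3) (G (put X p.*2.+1 (X p.*2.+2))))
    + sumD p.+1 G X + sumT p.+1 p.*2.+3 G X.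
Proof.
elim: p G X => [|p IH] G X mG; have [a [b [Y ->]]] := cons2P X.
  rewrite sumD_cons2 sumT_cons2 big_nat1 /sumD /sumT !big_geq //.
  have E x Z : Z 1 = x -> G (fun=> x) = G Z.
    by move=> <-; apply: mG.1 => -[|[|]].
  rewrite expr0 scale1r !subr0 /base /= /base /=.
  rewrite (E (tr a b (Y 1)) (put Y 1 (tr a b (Y 1)))) // (E (Y 1) Y) //.
  by rewrite (E b (put (cons2 a b Y) 1 b)) // (E a (cons2 a b Y)).
rewrite cobS IH ?sumD_cons2 ?sumT_cons2; last exact: mlin_contract2.
rewrite /lieder addn1 /contract2 /= !doubleS !put_cons2 exprS mulN1r scaleNr.
by zmod.
Qed.

End Fibre.

(** * Smooth local sections *)

Local Notation coord := Defs.coord.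

Section LocalSections.
Context (R : realType) (M : manifold R) (E : vbundle M) (q : nat)
  (s : local_triv E q) (U : set M) (oU : open U) (Us : U `<=` lt_dom s).
Implicit Types (sg tau : forall m, E m).

(** Sections are total functions on M, but only their values on [U] count; this admits [frame],
    which is arbitrary outside the domain of its trivialization. *)
Definition smooth_section sg :=
  forall j, smooth_fun U (fun m => coord s j (sg m)).

Lemma coord_linear m j : lt_dom s m -> linear_for *%R (@coord R M E q s j m).
Proof. by move=> sm k u v; rewrite /coord (lt_linear sm) !mxE. Qed.

Lemma coord_frame m i j : lt_dom s m -> coord s j (frame s i m) = (j == i)%:R.
Proof. by move=> sm; rewrite /coord /frame lt_invK // mxE. Qed.

Lemma coord_inj m (u v : E m) : lt_dom s m ->
  (forall j, coord s j u = coord s j v) -> u = v.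
Proof.
move=> sm uv; rewrite -(lt_mapK u sm) -(lt_mapK v sm); congr lt_inv.
by apply/rowP => j; exact: uv.
Qed.

Lemma coordD m j (u v : E m) : lt_dom s m ->
  coord s j (u + v) = coord s j u + coord s j v.
Proof. by move=> sm; have := coord_linear j sm 1 u v; rewrite scale1r mul1r. Qed.

Lemma coord0 m j : lt_dom s m -> coord s j (0 : E m) = 0.
Proof.
move=> sm; have := coord_linear j sm (-1) 0 0.
by rewrite scaler0 addr0 mulN1r addNr.
Qed.

Lemma coordZ m j k (u : E m) : lt_dom s m -> coord s j (k *: u) = k * coord s j u.
Proof.
by move=> sm; have := coord_linear j sm k u 0; rewrite !addr0 coord0 // addr0.
Qed.

Lemma coord_sum m j (I : Type) (l : seq I) (u : I -> E m) : lt_dom s m ->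
  coord s j (\sum_(i <- l) u i) = \sum_(i <- l) coord s j (u i).
Proof.
by move=> sm; apply: big_morph => [x y|]; [exact: coordD|exact: coord0].
Qed.

Lemma coord_expand m (v : E m) : lt_dom s m ->
  v = \sum_j coord s j v *: frame s j m.
Proof.
move=> sm; apply: coord_inj => // j; rewrite coord_sum // (bigD1 j) //=.
rewrite coordZ // coord_frame // eqxx mulr1 big1 ?addr0 // => i ij.
by rewrite coordZ // coord_frame // eq_sym (negPf ij) mulr0.
Qed.

Lemma smooth_section_eq sg tau :
  (forall m, U m -> sg m = tau m) -> smooth_section sg -> smooth_section tau.
Proof.
by move=> e ssg j; apply: smooth_fun_eq (ssg j) => // m Um; rewrite e.
Qed.

Lemma smooth_section_frame i : smooth_section (frame s i).
Proof.
move=> j; apply: smooth_fun_eq (smooth_fun_cst oU (j == i)%:R) => // m Um.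
by rewrite coord_frame //; exact: Us.
Qed.

Lemma smooth_section0 : smooth_section (fun=> 0).
Proof.
move=> j; apply: smooth_fun_eq (smooth_fun_cst oU 0) => // m Um.
by rewrite coord0 //; exact: Us.
Qed.

Lemma smooth_sectionZ (h : M -> R) sg : smooth_fun U h -> smooth_section sg ->
  smooth_section (fun m => h m *: sg m).
Proof.
move=> sh ssg j; apply: smooth_fun_eq (smooth_funM oU sh (ssg j)) => // m Um.
by rewrite coordZ //; exact: Us.
Qed.

Lemma smooth_sectionD sg tau : smooth_section sg -> smooth_section tau ->
  smooth_section (fun m => sg m + tau m).
Proof.
move=> ssg st j; apply: smooth_fun_eq (smooth_funD oU (ssg j) (st j)) => // m Um.
by rewrite coordD //; exact: Us.
Qed.

Lemma smooth_sectionB sg tau : smooth_section sg -> smooth_section tau ->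
  smooth_section (fun m => sg m - tau m).
Proof.
move=> ssg st; apply: smooth_section_eq
  (smooth_sectionD ssg (smooth_sectionZ (smooth_fun_cst oU (-1)) st)) => m _.
by rewrite scaleN1r.
Qed.

Lemma smooth_section_sum (I : Type) (l : seq I) (sg : I -> forall m, E m) :
  (forall i, smooth_section (sg i)) ->
  smooth_section (fun m => \sum_(i <- l) sg i m).
Proof.
move=> ssg; elim: l => [|i l IH].
  by apply: smooth_section_eq smooth_section0 => m _; rewrite big_nil.
by apply: smooth_section_eq (smooth_sectionD (ssg i) IH) => m _; rewrite big_cons.
Qed.

End LocalSections.

Section MultilinearSmooth.
Context (R : realType) (M : manifold R) (E F : vbundle M) (q q' : nat)
  (s : local_triv E q) (t : local_triv F q') (U : set M) (oU : open U)
  (Us : U `<=` lt_dom s) (Ut : U `<=` lt_dom t).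

(* The arguments are expanded in the frame one at a time, starting with the
   first one. *)
Lemma smooth_multilinear n (phi : forall m, ('I_n -> E m) -> F m) :
  (forall m, multilinear (phi m)) ->
  (forall I : 'I_n -> 'I_q,
     smooth_section t U (fun m => phi m (fun k => frame s (I k) m))) ->
  forall sg : 'I_n -> forall m, E m,
  (forall i, smooth_section s U (sg i)) ->
  smooth_section t U (fun m => phi m (fun k => sg k m)).
Proof.
move=> ml sf.
suff H k (sg : 'I_n -> forall m, E m) :
    (forall i : 'I_n, (i < k)%N -> smooth_section s U (sg i)) ->
    (forall i : 'I_n, (k <= i)%N -> exists l, sg i = frame s l) ->
    smooth_section t U (fun m => phi m (fun k => sg k m)).
  move=> sg ssg; apply: (H n) => i; first by move=> _; exact: ssg.
  by rewrite leqNgt ltn_ord.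
elim: k sg => [|k IH] sg ssg fsg.
  have /fin_all_exists[I eI] := fun i => fsg i isT.
  apply: smooth_section_eq (sf I) => // m _; congr phi.
  by apply/funext => i; rewrite eI.
have [nk|kn] := leqP n k.
  apply: IH => i ik; first by apply: ssg; exact: ltnW.
  by have := leq_trans (ltn_ord i) nk; rewrite ltnNge ik.
pose i0 := Ordinal kn.
pose sgl (l : 'I_q) i := if i == i0 then frame s l else sg i.
have ssgl l : smooth_section t U (fun m => phi m (fun k => sgl l k m)).
  apply: IH => i ik; rewrite /sgl; case: eqVneq => [ei|ni].
  - exact: smooth_section_frame.
  - by apply: ssg; exact: ltnW.
  - by exists l.
  - by apply: fsg; rewrite ltn_neqAle ik andbT eq_sym.
have := @smooth_section_sum _ _ _ _ t _ oU Ut _ (index_enum 'I_q)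
  (fun l m => coord s l (sg i0 m) *: phi m (fun k => sgl l k m)).
move=> /(_ (fun l => smooth_sectionZ oU Ut (ssg i0 (ltnSn k) l) (ssgl l))).
apply: smooth_section_eq => // m Um.
have lm := ml m i0 (fun i => sg i m).
transitivity (phi m (fun j => if j == i0
    then \sum_l coord s l (sg i0 m) *: frame s l m else sg j m)).
  rewrite (big_morph _ (linear_add lm) (linear_zero lm)).
  apply: eq_bigr => l _; rewrite (linear_scale lm); congr (_ *: phi m _).
  by apply/funext => j; rewrite /sgl; case: eqP.
rewrite -coord_expand; last exact: Us.
by congr phi; apply/funext => j; case: eqP => // ->.
Qed.

End MultilinearSmooth.

(** * The coboundary of a representation *)

Section FibreRep.
Context (R : realType) (M : manifold R) (xi : lie_yamaguti_bundle M)
  (eta : vbundle M) (r : representation xi eta) (m : M).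

Lemma rho_linear (w : eta m) : linear (fun a => rho r a w).
Proof.
by move=> k u v; have := (rho_smooth r).1 m w ord0 (fun=> 0) k u v; rewrite /=.
Qed.

Lemma rD_linearl b (w : eta m) : linear (fun a => rD r a b w).
Proof.
by move=> k u v; have := (rD_smooth r).1 m w ord0 (fun=> b) k u v; rewrite /=.
Qed.

Lemma rD_linearr a (w : eta m) : linear (fun b => rD r a b w).
Proof.
by move=> k u v; have := (rD_smooth r).1 m w ord_max (fun=> a) k u v; rewrite /=.
Qed.

Lemma theta_linearl b (w : eta m) : linear (fun a => theta r a b w).
Proof.
by move=> k u v; have := (theta_smooth r).1 m w ord0 (fun=> b) k u v; rewrite /=.
Qed.

Lemma theta_linearr a (w : eta m) : linear (fun b => theta r a b w).
Proof.
by move=> k u v; have := (theta_smooth r).1 m w ord_max (fun=> a) k u v; rewrite /=.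
Qed.

Definition fibre_rep : ly_rep (eta m) (@ly_br _ _ xi m) (@ly_tr _ _ xi m) :=
  LYRep rho_linear rD_linearl rD_linearr theta_linearl theta_linearr
    (@RLYB1 _ _ _ _ r m) (@RLYB2 _ _ _ _ r m) (@RLYB4 _ _ _ _ r m)
    (@RLYB5 _ _ _ _ r m) (@RLYB6 _ _ _ _ r m).

End FibreRep.

Section Args.
Context (R : realType) (V W : lmodType R).

(** Outside 1, ..., n+1 the round trip fills in repeated entries of the list, which locality makes
    invisible to [F]. *)
Lemma mlin_seq1_args n (F : (nat -> V) -> W) X : mlin n.+1 F ->
  F (seq1 (args n.+1 X)) = F X.
Proof.
case=> eF _; apply: eF => -[//|i] ni.
by rewrite /seq1 /args /= inordK.
Qed.

Lemma multilinear_args n (f : ('I_n -> V) -> W) : multilinear f ->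
  mlin n (fun X => f (args n X)).
Proof.
move=> lf; split=> [X Y XY|[//|i] X ni k u v].
  by congr f; apply/funext => i; apply: XY; rewrite /= ltn_ord.
have := lf (Ordinal ni) (args n X) k u v.
suff E w : (fun j => if j == Ordinal ni then w else args n X j)
  = args n (put X i.+1 w) by rewrite !E.
by apply/funext => j; rewrite /args /put eqSS -val_eqE.
Qed.

Lemma mlin_multilinear n (F : (nat -> V) -> W) : mlin n.+1 F ->
  multilinear (fun x : 'I_n.+1 -> V => F (seq1 x)).
Proof.
move=> mF i x k u v.
suff E w : F (seq1 (fun j => if j == i then w else x j))
    = F (put (seq1 x) i.+1 w) by rewrite !E (mlin_put _ _ _ _ mF) /=.
apply: mF.1 => -[//|j] nj; rewrite /seq1 /put /= eqSS -val_eqE.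
by rewrite /= inordK.
Qed.

End Args.

Section CoboundaryCob.
Context (R : realType) (M : manifold R) (xi : lie_yamaguti_bundle M)
  (eta : vbundle M) (r : representation xi eta) (p : nat)
  (f : forall m, ('I_p.*2 -> xi m) -> eta m)
  (g : forall m, ('I_p.*2.+1 -> xi m) -> eta m) (m : M).
Context (mf : multilinear (@f m)) (mg : multilinear (@g m)).

Let F X := @f m (args p.*2 X).
Let G X := @g m (args p.*2.+1 X).

Lemma deltaI_cob x : deltaI r f g x = cob (fibre_rep r m) false p F G (seq1 x).
Proof. by rewrite cob_deltaI //; exact: multilinear_args mg. Qed.

Lemma deltaII_cob x : deltaII r g x = cob (fibre_rep r m) true p G G (seq1 x).
Proof. by rewrite cob_deltaII //; exact: multilinear_args mg. Qed.

Let mF : mlin (p.*2 + false) F.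
Proof. by rewrite addn0; exact: multilinear_args mf. Qed.

Let mG : mlin (p.*2 + true) G.
Proof. by rewrite addn1; exact: multilinear_args mg. Qed.

Lemma mlin_cob_deltaI : mlin p.*2.+2 (cob (fibre_rep r m) false p F G).
Proof.
have := mlin_cob (ly_axioms xi m) (fibre_rep r m) mF
  (multilinear_args mg).
by rewrite addn0.
Qed.

Lemma mlin_cob_deltaII : mlin p.*2.+3 (cob (fibre_rep r m) true p G G).
Proof.
have := mlin_cob (ly_axioms xi m) (fibre_rep r m) mG
  (multilinear_args mg).
by rewrite addn1.
Qed.

(** The second coboundary is applied to this function of sequences; identifying it with [cob] is
    what makes [cob_cob] applicable. *)
Lemma deltaI_args X :
  deltaI r f g (args _ X) = cob (fibre_rep r m) false p F G X.
Proof. by rewrite deltaI_cob (mlin_seq1_args _ mlin_cob_deltaI). Qed.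

Lemma deltaII_args X :
  deltaII r g (args _ X) = cob (fibre_rep r m) true p G G X.
Proof. by rewrite deltaII_cob (mlin_seq1_args _ mlin_cob_deltaII). Qed.

Lemma multilinear_deltaI : multilinear (@deltaI _ _ _ _ r _ f g m).
Proof.
move=> i x k u v; rewrite !deltaI_cob.
exact: (mlin_multilinear mlin_cob_deltaI).
Qed.

Lemma multilinear_deltaII : multilinear (@deltaII _ _ _ _ r _ g m).
Proof.
move=> i x k u v; rewrite !deltaII_cob.
exact: (mlin_multilinear mlin_cob_deltaII).
Qed.

Lemma pair_alternating_deltaI : pair_alternating p F -> pair_alternating p G ->
  pair_alternating p.+1 (fun X => @deltaI _ _ _ _ r _ f g m (args _ X)).
Proof.
move=> aF aG X i ip Xi; rewrite deltaI_args.
have aC := pair_alternating_cob (ly_axioms xi m) (fibre_rep r m) mF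
  (multilinear_args mg) aF aG.
exact: (aC X i ip Xi).
Qed.

Lemma pair_alternating_deltaII : pair_alternating p G ->
  pair_alternating p.+1 (fun X => @deltaII _ _ _ _ r _ g m (args _ X)).
Proof.
move=> aG X i ip Xi; rewrite deltaII_args.
have aC := pair_alternating_cob (ly_axioms xi m) (fibre_rep r m) mG
  (multilinear_args mg) aG aG.
exact: (aC X i ip Xi).
Qed.

End CoboundaryCob.

Lemma deltaI_coboundary (R : realType) (M : manifold R)
    (xi : lie_yamaguti_bundle M) (eta : vbundle M) (r : representation xi eta)
    (p : nat) (f : forall m, ('I_p.*2 -> xi m) -> eta m)
    (g : forall m, ('I_p.*2.+1 -> xi m) -> eta m) (m : M)
    (x : 'I_p.+1.*2.+2 -> xi m) :
  multilinear (f m) -> multilinear (g m) ->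
  @deltaI _ _ _ _ r p.+1 (deltaI r f g) (deltaII r g) m x = 0.
Proof.
move=> mf mg; rewrite deltaI_cob; last exact: multilinear_deltaII.
rewrite (_ : (fun X => _) = cob (fibre_rep r m) false p
  (fun X => f m (args _ X)) (fun X => g m (args _ X))); last first.
  by apply/funext => X; exact: deltaI_args.
rewrite (_ : (fun X => deltaII _ _ _) = cob (fibre_rep r m) true p
  (fun X => g m (args _ X)) (fun X => g m (args _ X))); last first.
  by apply/funext => X; exact: deltaII_args.
apply: cob_cob; [exact: ly_axioms|rewrite addn0|]; exact: multilinear_args.
Qed.

Lemma deltaII_coboundary (R : realType) (M : manifold R)
    (xi : lie_yamaguti_bundle M) (eta : vbundle M) (r : representation xi eta)
    (p : nat) (g : forall m, ('I_p.*2.+1 -> xi m) -> eta m) (m : M)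
    (x : 'I_p.+1.*2.+3 -> xi m) :
  multilinear (g m) ->
  @deltaII _ _ _ _ r p.+1 (deltaII r g) m x = 0.
Proof.
move=> mg; rewrite deltaII_cob; last exact: multilinear_deltaII.
rewrite (_ : (fun X => deltaII _ _ _) = cob (fibre_rep r m) true p
  (fun X => g m (args _ X)) (fun X => g m (args _ X))); last first.
  by apply/funext => X; exact: deltaII_args.
apply: cob_cob; [exact: ly_axioms|rewrite addn1|]; exact: multilinear_args.
Qed.

(** * Smoothness of the coboundary *)

Section SmoothCoboundary.
Context (R : realType) (M : manifold R) (xi : lie_yamaguti_bundle M)
  (eta : vbundle M) (r : representation xi eta)
  (s : local_triv xi (vb_rank xi)) (t : local_triv eta (vb_rank eta)).

Let U := lt_dom s `&` lt_dom t.

Let oU : open U.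
Proof. by apply: openI; exact: lt_open. Qed.

Let Us : U `<=` lt_dom s. Proof. by move=> m []. Qed.

Let Ut : U `<=` lt_dom t. Proof. by move=> m []. Qed.

Implicit Types (a b c : forall m, xi m) (w : forall m, eta m).

Local Notation smooth_xi := (smooth_section s U).
Local Notation smooth_eta := (smooth_section t U).

Lemma smooth_br a b : smooth_xi a -> smooth_xi b ->
  smooth_xi (fun m => ly_br xi (a m) (b m)).
Proof.
move=> sa sb; have [ml sf] := ly_br_smooth xi.
pose sg (i : 'I_2) := if i == ord0 then a else b.
have ssg i : smooth_xi (sg i) by rewrite /sg; case: eqP.
have sfI (I : 'I_2 -> 'I_(vb_rank xi)) :
    smooth_xi (fun m => ly_br xi (frame s (I ord0) m) (frame s (I ord_max) m)).
  by move=> j; apply: smooth_fun_sub (sf s s I j) => m [].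
exact: (smooth_multilinear oU Us Us ml sfI ssg).
Qed.

Lemma smooth_tr a b c : smooth_xi a -> smooth_xi b -> smooth_xi c ->
  smooth_xi (fun m => ly_tr xi (a m) (b m) (c m)).
Proof.
move=> sa sb sc; have [ml sf] := ly_tr_smooth xi.
pose sg (i : 'I_3) := if i == ord0 then a else if i == inord 1 then b else c.
have ssg i : smooth_xi (sg i) by rewrite /sg; do 2?case: eqP.
have sfI (I : 'I_3 -> 'I_(vb_rank xi)) : smooth_xi (fun m =>
    ly_tr xi (frame s (I ord0) m) (frame s (I (inord 1)) m)
      (frame s (I ord_max) m)).
  by move=> j; apply: smooth_fun_sub (sf s s I j) => m [].
have := smooth_multilinear oU Us Us ml sfI ssg.
suff -> : (fun m => ly_tr xi (sg ord0 m) (sg (inord 1) m) (sg ord_max m))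
    = (fun m => ly_tr xi (a m) (b m) (c m)).
  by [].
by rewrite /sg -!val_eqE /= !inordK.
Qed.

(** Expanding [w] in the frame of eta reduces the claim to [h] applied to a fixed frame section,
    which is a multilinear map into eta. *)
Lemma smooth_end n (h : forall m, ('I_n -> xi m) -> {linear eta m -> eta m})
    (sg : 'I_n -> forall m, xi m) w :
  bundle_map_end h -> (forall i, smooth_xi (sg i)) -> smooth_eta w ->
  smooth_eta (fun m => h m (fun k => sg k m) (w m)).
Proof.
move=> [ml sf] ssg sw.
have sl l : smooth_eta (fun m => h m (fun k => sg k m) (frame t l m)).
  apply: (smooth_multilinear oU Us Ut
    (phi := fun m x => h m x (frame t l m))) => //.
  by move=> I j; exact: sf.
have := smooth_section_sum oU Ut (index_enum _)
  (fun l => smooth_sectionZ oU Ut (sw l) (sl l)).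
apply: smooth_section_eq => // m Um; rewrite [in RHS](coord_expand (w m) (Ut Um)).
by rewrite linear_sum; apply: eq_bigr => l _; rewrite linearZ.
Qed.

Lemma smooth_rho a w : smooth_xi a -> smooth_eta w ->
  smooth_eta (fun m => rho r (a m) (w m)).
Proof. by move=> sa; exact: (smooth_end (sg := fun=> a) (rho_smooth r)). Qed.

Lemma smooth_rD a b w : smooth_xi a -> smooth_xi b -> smooth_eta w ->
  smooth_eta (fun m => rD r (a m) (b m) (w m)).
Proof.
move=> sa sb; pose sg (i : 'I_2) := if i == ord0 then a else b.
by apply: (smooth_end (sg := sg) (rD_smooth r)) => i; rewrite /sg; case: eqP.
Qed.

Lemma smooth_theta a b w : smooth_xi a -> smooth_xi b -> smooth_eta w ->
  smooth_eta (fun m => theta r (a m) (b m) (w m)).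
Proof.
move=> sa sb; pose sg (i : 'I_2) := if i == ord0 then a else b.
by apply: (smooth_end (sg := sg) (theta_smooth r)) => i; rewrite /sg; case: eqP.
Qed.

(** Smoothness is tested on arbitrary smooth sections rather than on frames, because inserting
    brackets turns frame sections into general ones; in this form it passes through i and L. *)
Definition smooth_op (Phi : forall m, (nat -> xi m) -> eta m) :=
  forall X : forall m, nat -> xi m, (forall i, smooth_xi (fun m => X m i)) ->
  smooth_eta (fun m => Phi m (X m)).

Lemma smooth_op_args n (f : forall m, ('I_n -> xi m) -> eta m) :
  bundle_map f -> smooth_op (fun m X => f m (args n X)).
Proof.
move=> [ml sf] X sX; apply: (smooth_multilinear oU Us Ut ml) => [I j|i].
  exact: sf.
exact: sX.
Qed.

Lemma smooth_op_contract2 Phi a b : smooth_op Phi ->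
  smooth_xi a -> smooth_xi b ->
  smooth_op (fun m => contract2 (Phi m) (a m) (b m)).
Proof. by move=> sP sa sb X sX; apply: sP => -[|[|[|i]]] /=. Qed.

Lemma smooth_op_lieder n Phi a b : smooth_op Phi -> smooth_xi a -> smooth_xi b ->
  smooth_op (fun m => lieder (fibre_rep r m) n (a m) (b m) (Phi m)).
Proof.
move=> sP sa sb X sX; apply: smooth_sectionB => //.
  by apply: smooth_rD => //; exact: sP.
apply: smooth_section_sum => // j; apply: sP => i; rewrite /put.
by case: eqP => // _; exact: smooth_tr.
Qed.

Lemma smooth_op_base e (g : forall m, xi m -> eta m) :
  (forall a, smooth_xi a -> smooth_eta (fun m => g m (a m))) ->
  smooth_op (fun m => base (fibre_rep r m) e (g m)).
Proof.
move=> sg X sX; rewrite /base; case: e.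
  apply: smooth_sectionB => //; last by apply: sg; exact: smooth_tr.
  apply: smooth_sectionD => //; last by apply: smooth_rD => //; exact: sg.
  by apply: smooth_sectionB => //; apply: smooth_theta => //; exact: sg.
apply: smooth_sectionB => //; last by apply: sg; exact: smooth_br.
by apply: smooth_sectionB => //; apply: smooth_rho => //; exact: sg.
Qed.

Lemma smooth_op_cob e p Phi Psi : smooth_op Phi -> smooth_op Psi ->
  smooth_op (fun m => cob (fibre_rep r m) e p (Phi m) (Psi m)).
Proof.
elim: p Phi Psi => [|p IH] Phi Psi sP sQ.
  apply: (@smooth_op_base e (fun m u => Psi m (fun=> u))) => a sa.
  by apply: (sQ (fun m _ => a m)).
move=> X sX.
have soX i : smooth_xi (fun m => omit 1 (X m) i) by case: i => [|i]; exact: sX.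
apply: smooth_sectionB => //.
  exact: (smooth_op_lieder _ sP (sX 1) (sX 2) (X := fun m => omit 1 (X m))).
exact: (IH _ _ (smooth_op_contract2 sP (sX 1) (sX 2))
  (smooth_op_contract2 sQ (sX 1) (sX 2)) (fun m => omit 1 (X m))).
Qed.

End SmoothCoboundary.

(** * The coboundary maps cochains to cochains *)

Section CoboundaryCochains.
Context (R : realType) (M : manifold R) (xi : lie_yamaguti_bundle M)
  (eta : vbundle M) (r : representation xi eta) (p : nat)
  (f : forall m, ('I_p.*2 -> xi m) -> eta m)
  (g : forall m, ('I_p.*2.+1 -> xi m) -> eta m).
Arguments f m _ : clear implicits.
Arguments g m _ : clear implicits.

(** Pairs are counted from 1 in [cochains] and from 0 in [pair_alternating]. *)
Lemma cochains_pair_alternating n (h : forall m, ('I_n -> xi m) -> eta m) m :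
  cochains xi eta n h ->
  pair_alternating n./2 (fun X => h m (args n X)).
Proof. by move=> [_ ah] X i ni Xi; apply: (ah m X i.+1). Qed.

Lemma cochains_deltaI : cochains xi eta p.*2 f -> cochains xi eta p.*2.+1 g ->
  cochains xi eta p.+1.*2 (deltaI r f g).
Proof.
move=> hf hg; have [bf _] := hf; have [bg _] := hg.
have ml m : multilinear (@deltaI _ _ _ _ r p f g m).
  by apply: multilinear_deltaI; [exact: bf.1|exact: bg.1].
split; [split=> //|].
  move=> s t I j.
  have := smooth_op_cob r false p (smooth_op_args (s := s) (t := t) bf)
    (smooth_op_args (s := s) (t := t) bg).
  (* Evaluated on frame sections, [cob] yields exactly the local components whose smoothness
     [bundle_map] demands. *)
  move=> /(_ (fun m => seq1 (fun k => frame s (I k) m))) H.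
  apply: smooth_fun_eq (H _ j).
  - by apply: openI; exact: lt_open.
  - by move=> m _; rewrite deltaI_cob //; exact: bg.1.
  - move=> i; apply: smooth_section_frame => [|m []//].
    by apply: openI; exact: lt_open.
move=> m X [//|i] ip Xi.
have aI := pair_alternating_deltaI r (bf.1 m) (bg.1 m).
apply: (aI _ _ X i) => //.
- by have := cochains_pair_alternating (m := m) hf; rewrite doubleK.
- by have := cochains_pair_alternating (m := m) hg; rewrite /= uphalf_double.
- by move: ip; rewrite doubleK.
Qed.

Lemma cochains_deltaII : cochains xi eta p.*2.+1 g ->
  cochains xi eta p.+1.*2.+1 (deltaII r g).
Proof.
move=> hg; have [bg _] := hg.
have ml m : multilinear (@deltaII _ _ _ _ r p g m).
  by apply: multilinear_deltaII; exact: bg.1.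
split; [split=> //|].
  move=> s t I j.
  have := smooth_op_cob r true p (smooth_op_args (s := s) (t := t) bg)
    (smooth_op_args (s := s) (t := t) bg).
  move=> /(_ (fun m => seq1 (fun k => frame s (I k) m))) H.
  apply: smooth_fun_eq (H _ j).
  - by apply: openI; exact: lt_open.
  - by move=> m _; rewrite deltaII_cob //; exact: bg.1.
  - move=> i; apply: smooth_section_frame => [|m []//].
    by apply: openI; exact: lt_open.
move=> m X [//|i] ip Xi.
have aII := pair_alternating_deltaII r (bg.1 m).
apply: (aII _ X i) => //.
- by have := cochains_pair_alternating (m := m) hg; rewrite /= uphalf_double.
- by move: ip; rewrite /= uphalf_double.
Qed.

End CoboundaryCochains.

Theorem lemma5p2 (R : realType) (M : manifold R) (xi : lie_yamaguti_bundle M)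
    (eta : vbundle M) (r : representation xi eta) (p : nat) (hp : (1 <= p)%N)
    (f : forall m : M, ('I_p.*2 -> xi m) -> eta m)
    (g : forall m : M, ('I_p.*2.+1 -> xi m) -> eta m)
    (hf : cochains xi eta p.*2 f) (hg : cochains xi eta p.*2.+1 g) :
  (cochains xi eta p.+1.*2 `*` cochains xi eta p.+1.*2.+1)
    (coboundary r p (f, g)) /\
  coboundary r p.+1 (coboundary r p (f, g))
    = ((fun m _ => 0), (fun m _ => 0)).
Proof.
split; first by split; [exact: cochains_deltaI|exact: cochains_deltaII].
have [[mf _] _] := hf; have [[mg _] _] := hg.
congr pair; apply: functional_extensionality_dep => m; apply/funext => x.
  exact: deltaI_coboundary.
exact: deltaII_coboundary.
Qed.
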